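(* For each positive integer $k\ge1$, $$\zeta_{F_2}\begin{pmatrix}k\\\omega\end{pmatrix}=\frac{\pi}{2}\sum_{\mathbf l\in\mathbb I_{k-1}}\frac{(\log2)^{l_1}}{l_1!}\prod_{j=2}^{|\mathbf l|}\frac1{l_j!}\left\{\frac{1-2^{1-j}}{j}\zeta(j)\right\}^{l_j},$$ where $\zeta$ is the Riemann zeta function, $\mathbb I_0:=\{(0)\}$, and for $k\ge2$ $$\mathbb I_{k-1}:=\left\{(l_1,\dots,l_s)\in\bigsqcup_{m>0}(\mathbb Z_{\ge0})^m~\middle|~\sum_{j\ge1}jl_j=k-1,\ l_s\ne0\right\},$$ $|\mathbf l|:=s$ for $\mathbf l=(l_1,\dots,l_s)$, and the product over $j$ is $1$ when $|\mathbf l|=1$.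
   Context: With $\omega=\frac{dx}{\sqrt{1-x^2}}$ and $\omega_0=\frac{dx}{x}$ on $[0,1]$, $$\zeta_{F_2}\begin{pmatrix}k\\\omega\end{pmatrix}=\int_{0<t_1<\dots<t_k<1}\frac{dt_1}{\sqrt{1-t_1^2}}\frac{dt_2}{t_2}\cdots\frac{dt_k}{t_k}.$$ *)

(* Defs.v *)
From HB Require Import structures.
From mathcomp Require Import all_boot all_order all_algebra.
From mathcomp Require Import all_classical all_reals all_analysis.

Set Implicit Arguments.
Unset Strict Implicit.
Unset Printing Implicit Defensive.

Import Order.TTheory GRing.Theory Num.Theory.
Import numFieldNormedType.Exports.

Local Open Scope classical_set_scope.
Local Open Scope ring_scope.

Section lebesgue_tuple.
Context {R : realType}.
Local Open Scope ereal_scope.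

Definition tuple_cons n (p : R * n.-tuple R) : n.+1.-tuple R :=
  [tuple of p.1 :: p.2].

Lemma measurable_tuple_cons n : measurable_fun setT (@tuple_cons n).
Proof. exact: measurable_cons. Qed.

(* n-dimensional Lebesgue measure on n.-tuple R with the product
   sigma-algebra: the n-fold product of [lebesgue_measure], transported along
   R * n.-tuple R -> n.+1.-tuple R; on the one-point space 0.-tuple R it is
   the unit mass. *)
Fixpoint lebesgue_tuple n : set (n.-tuple R) -> \bar R :=
  match n with
  | 0 => \d_([tuple] : 0.-tuple R)
  | m.+1 => pushforward (lebesgue_measure \x lebesgue_tuple (n := m))
              (@tuple_cons m)
  end.

Section lebesgue_tupleS.
Variables (n : nat) (mu : {sigma_finite_measure set (n.-tuple R) -> \bar R}).

Definition lebesgue_tupleS : set (n.+1.-tuple R) -> \bar R :=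
  pushforward (lebesgue_measure \x mu) (@tuple_cons n).

Let P : {measure set (n.+1.-tuple R) -> \bar R} :=
  measure_function_pushforward__canonical__measure_function_Measure
    (@lebesgue_measure R \x mu)%E (@measurable_tuple_cons n).

Let P0 : lebesgue_tupleS set0 = 0.
Proof. exact: (measure0 P). Qed.

Let P_ge0 A : 0 <= lebesgue_tupleS A.
Proof. exact: (measure_ge0 P). Qed.

Let P_sigma_additive : semi_sigma_additive lebesgue_tupleS.
Proof. exact: (@measure_semi_sigma_additive _ _ _ P). Qed.

HB.instance Definition _ := isMeasure.Build _ _ _ lebesgue_tupleS
  P0 P_ge0 P_sigma_additive.

(* The library's canonical sigma-finite instance for \x applies to
   subprobabilities only, so exhausting rectangles are exhibited here. *)
Let P_sigma_finite : sigma_finite setT lebesgue_tupleS.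
Proof.
have /sigma_finiteP[F [FT ndF Foo]] := sigma_finiteT (@lebesgue_measure R).
have /sigma_finiteP[G [GT ndG Goo]] := sigma_finiteT mu.
pose h (t : n.+1.-tuple R) : R * n.-tuple R :=
  (tnth t ord0, [tuple of behead t]).
have hK : cancel (@tuple_cons n) h.
  by case=> x t; congr pair; apply/val_inj.
have mh : measurable_fun setT h.
  by apply/measurable_fun_pairP; split;
    [exact: measurable_tnth|exact: measurable_behead].
exists (fun i => h @^-1` (F i `*` G i)).
  apply/esym; rewrite -subTset => t _.
  have [i _ Fi] : (\bigcup_i F i) (h t).1 by rewrite -FT.
  have [j _ Gj] : (\bigcup_i G i) (h t).2 by rewrite -GT.
  exists (maxn i j) => //; split.
  - by move: Fi; exact/subsetPset/ndF/leq_maxl.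
  - by move: Gj; exact/subsetPset/ndG/leq_maxr.
move=> i; have [mF Fi] := Foo i; have [mG Gi] := Goo i; split.
  by rewrite -[X in measurable X]setTI; apply: mh => //; exact: measurableX.
rewrite /lebesgue_tupleS /pushforward -comp_preimage.
rewrite (_ : h \o _ = id); last by apply/funext => x /=; rewrite hK.
by rewrite preimage_id product_measure1E// lte_mul_pinfty// ge0_fin_numE.
Qed.

HB.instance Definition _ := Measure_isSigmaFinite.Build _ _ _ lebesgue_tupleS
  P_sigma_finite.
End lebesgue_tupleS.

Let lebesgue_tuple_ex n :
  exists mu : {sigma_finite_measure set (n.-tuple R) -> \bar R},
    @lebesgue_tuple n = mu.
Proof.
elim: n => [|n [mu muE]].
  by exists (\d_([tuple] : 0.-tuple R)).
by exists (lebesgue_tupleS mu); rewrite /= muE.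
Qed.

Let lebesgue_tuple0 n : @lebesgue_tuple n set0 = 0.
Proof. by have [mu ->] := lebesgue_tuple_ex n. Qed.

Let lebesgue_tuple_ge0 n A : 0 <= @lebesgue_tuple n A.
Proof. by have [mu ->] := lebesgue_tuple_ex n. Qed.

Let lebesgue_tuple_sigma_additive n : semi_sigma_additive (@lebesgue_tuple n).
Proof.
by have [mu ->] := lebesgue_tuple_ex n; exact: measure_semi_sigma_additive.
Qed.

HB.instance Definition _ n := isMeasure.Build _ _ _ (@lebesgue_tuple n)
  (lebesgue_tuple0 n) (@lebesgue_tuple_ge0 n)
  (@lebesgue_tuple_sigma_additive n).

Let lebesgue_tuple_sigma_finite n : sigma_finite setT (@lebesgue_tuple n).
Proof. by have [mu ->] := lebesgue_tuple_ex n; exact: sigma_finiteT. Qed.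

HB.instance Definition _ n := Measure_isSigmaFinite.Build _ _ _
  (@lebesgue_tuple n) (@lebesgue_tuple_sigma_finite n).

End lebesgue_tuple.
Arguments lebesgue_tuple {R} n.

Section iterated_integral.
Context {R : realType}.

(* The open simplex 0 < t_1 < ... < t_k < 1. *)
Definition open_simplex k : set (k.-tuple R) :=
  [set t | path <%R 0 (rcons t 1)].

(* A 1-form f(x) dx on ]0, 1[ is given by its density f. *)
Definition iterated_integral k (f : 'I_k -> R -> R) : \bar R :=
  \int[lebesgue_tuple k]_(t in @open_simplex k)
    (\prod_(i < k) f i (tnth t i))%:E.

Definition omega (x : R) : R := (Num.sqrt (1 - x ^+ 2))^-1.

Definition omega0 (x : R) : R := x^-1.

(* Index 0 : 'I_k carries the innermost variable t_1. *)
Definition zetaF2 (k : nat) (w : R -> R) : \bar R :=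
  iterated_integral (fun i : 'I_k => if i == 0%N :> nat then w else omega0).

(* The Riemann zeta function for a real argument s > 1; the limit is a junk
   value otherwise. *)
Definition riemann_zeta (s : R) : R :=
  limn (series (fun n => n.+1%:R `^ (- s))).

End iterated_integral.

Definition part (l : seq nat) (j : nat) : nat := nth 0%N l j.-1.

(* The index set I_n, with (l_1, ..., l_s) encoded as the list
   [:: l_1; ...; l_s], so that l_j is [part l j]. *)
Definition index_set (n : nat) : set (seq nat) :=
  if n == 0%N then [set [:: 0%N]] else
  [set l | [/\ (0 < size l)%N,
               (\sum_(1 <= j < (size l).+1) j * part l j = n)%N &
               part l (size l) <> 0%N]].

Lemma finite_index_set n : finite_set (index_set n).
Proof.
rewrite /index_set; case: ifPn => [_|_]; first exact: finite_set1.
pose B := (n.+1).-bseq 'I_n.+1.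
apply: (@sub_finite_set _ _ ((fun b : B => map val b) @` setT)); last first.
  exact/finite_image/finite_finset.
move=> l [l0 ln lN].
have le_n j : (0 < j <= size l)%N -> (j * part l j <= n)%N.
  move=> /andP[j0 jl]; rewrite -ln (bigD1_seq j) ?iota_uniq//= ?leq_addr//.
  by rewrite mem_index_iota j0 ltnS.
have sl : (size l <= n.+1)%N.
  rewrite ltnW// ltnS (leq_trans _ (le_n (size l) _)) ?l0/= ?leqnn//.
  by rewrite leq_pmulr// lt0n; apply/eqP.
have ll x : x \in l -> (x < n.+1)%N.
  move=> xl; have il : (index x l < size l)%N by rewrite index_mem.
  have := le_n (index x l).+1; rewrite /= il /part /= nth_index// => /(_ isT).
  by rewrite ltnS; apply: leq_trans; rewrite leq_pmull.
have bP : (size [seq inord x : 'I_n.+1 | x <- l] <= n.+1)%N by rewrite size_map.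
exists (Bseq bP) => //=.
rewrite -map_comp -[RHS]map_id; apply/eq_in_map => x /ll xn /=.
exact: inordK.
Qed.

(* Main.v *)
Require Import Defs.
From HB Require Import structures.
From mathcomp Require Import all_boot all_order all_algebra.
From mathcomp Require Import all_classical all_reals all_analysis.
From mathcomp Require Import measurable_realfun.
From mathcomp Require Import ring lra.

Import Order.TTheory GRing.Theory Num.Theory.
Import numFieldNormedType.Exports.

Local Open Scope classical_set_scope.
Local Open Scope ring_scope.

(* Integrating t_2, ..., t_k first gives zeta(k) = A_(k-1), where A_n is the
   integral over ]0, 1[ of (- ln t)^n / n! dt / sqrt (1 - t^2).  Let A_n(s) be
   the same integral with an additional factor t^s.  Integrating the derivative
   of t^(s+1) (- ln t)^n / n! sqrt (1 - t^2) yields, for the generating series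
   A(s) = sum_n A_n(s) X^n, the identity (s+2 - X) A(s+2) = (s+1 - X) A(s), so
   B_N = A(2N) / A_0(2N) satisfies
     B_0 = prod_(m <= 2N) (1 - X/m)^((-1)^m) * B_N.
   The coefficients of B_N tend to those of 1, and those of the product are
   determined by Newton's identities from the power sums
   sum_(m <= 2N) (-1)^(m-1) m^(-j), which tend to ln 2 for j = 1 and to
   (1 - 2^(1-j)) zeta(j) for j >= 2.  Hence
     A(0) = pi/2 exp (ln 2 X + sum_(j >= 2) (1 - 2^(1-j)) zeta(j) X^j / j),
   and expanding the exponential gives the sum over partitions. *)

(** * Power series as coefficient sequences *)

Section Convolution.
Context {R : comNzRingType}.
Implicit Types u v w : nat -> R.

Definition conv u v n : R := \sum_(i < n.+1) u i * v (n - i)%N.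

(** Truncating at any degree at least n leaves coefficient n intact, so the ring laws of polynomials
    carry over to [conv]. *)
Lemma conv_coefM u v N n : (n <= N)%N ->
  conv u v n = (\poly_(i < N.+1) u i * \poly_(i < N.+1) v i)`_n.
Proof.
move=> nN; rewrite coefM; apply: eq_bigr => i _.
have iN : (i <= N)%N by rewrite (leq_trans _ nN)// -ltnS.
by rewrite !coef_poly !ltnS iN (leq_trans (leq_subr _ _) nN).
Qed.

Lemma eq_conv u u' v v' n : (forall i, (i <= n)%N -> u i = u' i) ->
  (forall i, (i <= n)%N -> v i = v' i) -> conv u v n = conv u' v' n.
Proof.
move=> uu' vv'; apply: eq_bigr => i _.
by rewrite uu' ?vv' ?leq_subr// -ltnS.
Qed.

Lemma convC u v : conv u v = conv v u.
Proof. by apply/funext => n; rewrite !(@conv_coefM _ _ n n)// mulrC. Qed.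

Lemma convA u v w : conv u (conv v w) = conv (conv u v) w.
Proof.
apply/funext => n; set T := fun f : nat -> R => \poly_(i < n.+1) f i.
transitivity ((T u * (T v * T w))`_n).
  rewrite coefM; apply: eq_bigr => i _.
  by rewrite -conv_coefM ?leq_subr// coef_poly ltn_ord.
rewrite mulrA coefM; apply: eq_bigr => i _.
by rewrite -conv_coefM -1?ltnS// coef_poly ltnS leq_subr.
Qed.

Lemma convDl u u' v : conv (u \+ u') v = conv u v \+ conv u' v.
Proof.
apply/funext => n; rewrite /conv/= -big_split.
by apply: eq_bigr => i _; rewrite mulrDl.
Qed.

Definition conv1 (n : nat) : R := (n == 0%N)%:R.

Lemma conv1l u : conv conv1 u = u.
Proof.
apply/funext => n; rewrite /conv big_ord_recl big1 ?addr0 ?mul1r ?subn0//.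
by move=> i _; rewrite mul0r.
Qed.

Definition der u n : R := n.+1%:R * u n.+1.

Lemma der_conv u v : der (conv u v) = conv (der u) v \+ conv u (der v).
Proof.
apply/funext => n; rewrite /der /conv mulr_sumr.
(* The weight n+1 is split as i + (n+1-i), one share for each factor. *)
rewrite (eq_bigr (fun i : 'I_n.+2 => i%:R * u i * v (n.+1 - i)%N +
    u i * ((n.+1 - i)%:R * v (n.+1 - i)%N))); last first.
  move=> i _; rewrite -{1}(subnKC (_ : i <= n.+1)%N); last by rewrite -ltnS.
  by rewrite natrD; ring.
rewrite big_split/=; congr (_ + _).
  by rewrite big_ord_recl mul0r mul0r add0r; apply: eq_bigr => i _.
rewrite big_ord_recr/= subnn mul0r mulr0 addr0; apply: eq_bigr => i _.
by rewrite subSn// -ltnS.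
Qed.

End Convolution.

(** * Newton's identities and exponentials of power series *)

Section Newton.
Context {R : numFieldType}.
Implicit Types p q e f : nat -> R.

(* As formal power series, e = exp (sum_j p j X^(j+1) / (j+1)); the Newton
   identities, with p j the power sum of exponent j+1. *)
Definition newton p e := e 0%N = 1 /\ forall n, der e n = conv p e n.

(** The identities form a recursion, since n+1 is invertible; coefficient n depends on the power
    sums of index below n only. *)
Lemma newton_uniq p q e f n : newton p e -> newton q f ->
  (forall j, (j < n)%N -> p j = q j) -> e n = f n.
Proof.
move=> [e0 eS] [f0 fS]; elim/ltn_ind: n => -[|n] IH pq; first by rewrite e0 f0.
apply: (mulfI (_ : n.+1%:R != 0)); first by rewrite pnatr_eq0.
have := eS n; rewrite /der => ->; have := fS n; rewrite /der => ->.
apply: eq_conv => i ni; first exact: pq.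
by apply: IH => // j ji; apply: pq; rewrite (leq_trans ji)// ltnW.
Qed.

(** In this reading p is the logarithmic derivative e'/e, which turns products into sums. *)
Lemma newton_conv p q e f : newton p e -> newton q f ->
  newton (p \+ q) (conv e f).
Proof.
move=> [e0 eS] [f0 fS]; split; first by rewrite /conv big_ord1 e0 f0 mulr1.
move=> n; rewrite der_conv convDl (_ : der e = conv p e); last exact/funext.
rewrite (_ : der f = conv q f); last exact/funext.
by rewrite -convA [conv e (conv q f)]convA (convC e q) -convA.
Qed.

Lemma newton0 : newton (fun=> 0) conv1.
Proof.
split => // n; rewrite /der mulr0 /conv big1// => i _; exact: mul0r.
Qed.

Lemma newton_geometric (y : R) : newton (fun j => y ^+ j.+1) (fun n => y ^+ n).
Proof.
split => // n; rewrite /conv (eq_bigr (fun=> y ^+ n.+1)).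
  by rewrite sumr_const card_ord -[RHS]mulr_natl.
by move=> i _; rewrite -exprD addSn subnKC// -ltnS.
Qed.

(** The coefficients of 1 - z X, the inverse of the geometric series in z X. *)
Definition binom1 (z : R) (n : nat) : R :=
  if n is n'.+1 then (if n' is 0%N then - z else 0) else 1.

Lemma conv_binom1S z e n : conv (binom1 z) e n.+1 = e n.+1 - z * e n.
Proof.
rewrite /conv 2!big_ord_recl big1/= ?addr0; last by move=> i _; rewrite mul0r.
by rewrite mul1r mulNr subn0 subSS subn0.
Qed.

Lemma newton_linear z : newton (fun j => - z ^+ j.+1) (binom1 z).
Proof.
split => // n; rewrite convC; case: n => [|n].
  by rewrite /der /conv big_ord1/= mul1r.
by rewrite conv_binom1S /der/= mulr0 [z ^+ n.+2]exprS; ring.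
Qed.

Lemma conv_geometric_linear (y : R) :
  conv (fun n => y ^+ n) (binom1 y) = conv1.
Proof.
rewrite convC; apply/funext => -[|n]; first by rewrite /conv big_ord1 mulr1.
by rewrite conv_binom1S exprS subrr.
Qed.

(* The coefficients of exp (c X^(j+1)). *)
Definition exp_monomial (c : R) (j n : nat) : R :=
  if (j.+1 %| n)%N then c ^+ (n %/ j.+1) / (n %/ j.+1)`!%:R else 0.

(** The logarithmic derivative of exp (c X^(j+1)) is the single term c (j+1) X^j. *)
Lemma newton_exp_monomial c j :
  newton (fun i => (i == j)%:R * (c * j.+1%:R)) (exp_monomial c j).
Proof.
split => [|n]; first by rewrite /exp_monomial dvdn0 div0n fact0 divr1.
have E m : (m < j)%N -> exp_monomial c j m.+1 = 0.
  by move=> mj; rewrite /exp_monomial gtnNdvd.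
have [nj|jn] := ltnP n j.
  rewrite /der E// mulr0 /conv big1// => i _.
  by rewrite ltn_eqF ?mul0r// (leq_ltn_trans _ nj)// -ltnS.
have jn' : (j < n.+1)%N by [].
rewrite /conv (bigD1 (Ordinal jn'))//= big1 ?addr0; last first.
  by move=> i; rewrite -val_eqE/= => /negPf ->; rewrite !mul0r.
rewrite eqxx mul1r /der /exp_monomial.
have -> : n.+1 = (j.+1 + (n - j))%N by rewrite addSn subnKC.
rewrite dvdn_addr// divnDl// divnn/= add1n.
case: ifPn => [/dvdnP[q ->]|_]; last by rewrite !mulr0.
rewrite mulnK// -mulSn factS !natrM exprS.
have q1 : q.+1%:R != 0 :> R by rewrite pnatr_eq0.
have qf : q`!%:R != 0 :> R by rewrite pnatr_eq0 -lt0n fact_gt0.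
by field; rewrite qf nat1r q1.
Qed.

Fixpoint exp_prod (c : nat -> R) m : nat -> R :=
  if m is m'.+1 then conv (exp_prod c m') (exp_monomial (c m') m') else conv1.

Lemma newton_exp_prod c m :
  newton (fun j => (j < m)%:R * (c j * j.+1%:R)) (exp_prod c m).
Proof.
elim: m => [|m IH].
  rewrite (_ : (fun _ => _) = fun=> 0)//=; first exact: newton0.
  by apply/funext => j; exact: mul0r.
rewrite [X in newton X](_ : _ = (fun j => (j < m)%:R * (c j * j.+1%:R)) \+
    (fun i => (i == m)%:R * (c m * m.+1%:R))).
  exact: newton_conv IH (newton_exp_monomial _ _).
apply/funext => j /=; rewrite ltnS leq_eqVlt orbC.
case: ltngtP => [jm|jm|->]/=; rewrite ?mul0r ?addr0 ?add0r//.
Qed.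

(** Factors of index n or more do not affect coefficient n, so the diagonal gives the coefficients
    of the infinite product of the exp (c_j X^(j+1)). *)
Lemma newton_exp_prod_diag c :
  newton (fun j => c j * j.+1%:R) (fun n => exp_prod c n n).
Proof.
have E n : newton (fun j => (j < n)%:R * (c j * j.+1%:R)) (exp_prod c n).
  exact: newton_exp_prod.
split => // n; rewrite /der; have [_ /(_ n)] := E n.+1; rewrite /der => ->.
apply: eq_conv => i ni; first by rewrite ltnS ni mul1r.
apply: newton_uniq (E _) (E _) _ => j ji.
by rewrite ji (ltn_trans ji).
Qed.

(** A term X^((j+1) l) that contributes to a coefficient of index at most N has l <= N, so each
    exponential series may be cut at N. *)
Lemma exp_prod_coef c N m n : (n <= N)%N ->
  exp_prod c m n =
  (\prod_(j < m) \sum_(l < N.+1)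
     (c j ^+ l / l`!%:R) *: 'X^(j.+1 * l) : {poly R})`_n.
Proof.
elim: m n => [|m IH] n nN; first by rewrite big_ord0 coef1.
rewrite big_ord_recr/= coefM; apply: eq_bigr => i _.
rewrite -IH; last by rewrite (leq_trans _ nN)// -ltnS.
congr (_ * _); rewrite coef_sum /exp_monomial.
have {}nN : (n - i <= N)%N by rewrite (leq_trans (leq_subr _ _)).
case: ifPn => [/dvdnP[q qE]|nd].
  have qN : (q < N.+1)%N by rewrite ltnS (leq_trans _ nN)// qE leq_pmulr.
  rewrite (bigD1 (Ordinal qN))//= big1 => [|k].
    by rewrite addr0 coefZ coefXn qE mulnC eqxx mulr1 mulnC mulnK.
  rewrite -val_eqE/= coefZ coefXn qE mulnC eqn_mul2l/= eq_sym => /negPf ->.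
  by rewrite mulr0.
rewrite big1// => k _; rewrite coefZ coefXn.
by case: eqP => [E|_]; [rewrite E dvdn_mulr in nd|rewrite mulr0].
Qed.

(** Distributing the product over the sums gives one monomial for each choice f of exponents, of
    degree sum_j (j+1) f_j; those of degree n remain. *)
Lemma newton_partitions c e n : newton (fun j => c j * j.+1%:R) e ->
  e n = \sum_(f : {ffun 'I_n -> 'I_n.+1} | (\sum_(j < n) j.+1 * f j == n)%N)
          \prod_(j < n) (c j ^+ f j / (f j)`!%:R).
Proof.
move=> eP; rewrite (newton_uniq _ _ _ _ _ eP (newton_exp_prod_diag c))//.
rewrite (@exp_prod_coef _ n)// bigA_distr_bigA/= coef_sum.
rewrite [RHS]big_mkcond/=; apply: eq_bigr => f _.
rewrite (eq_bigr (fun j : 'I_n =>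
    (c j ^+ f j / (f j)`!%:R)%:P * 'X^(j.+1 * f j))).
  rewrite big_split/= -rmorph_prod/= mul_polyC coefZ prodrXr coefXn eq_sym.
  by case: ifP; rewrite ?mulr1 ?mulr0.
by move=> j _; rewrite mul_polyC.
Qed.

End Newton.

(** * Partitions: lists of multiplicities and finite functions *)

Section IndexSet.

Lemma trim_zeros (s : seq nat) : exists l : seq nat,
  [/\ nth 0%N l =1 nth 0%N s, (size l <= size s)%N &
      (0 < size l)%N -> part l (size l) <> 0%N].
Proof.
elim/last_ind: s => [|s x [l [ls sl lN]]]; first by exists [::].
have [->|/eqP x0] := eqVneq x 0%N.
  exists l; split=> // [i|]; last by rewrite size_rcons ltnW.
  rewrite ls nth_rcons.
  by case: ltngtP => // [?|->]; rewrite nth_default// ltnW.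
exists (rcons s x); split=> // _.
by rewrite /part nth_rcons size_rcons ltnn eqxx.
Qed.

(** The last entry is nonzero, so its term alone in the weighted sum is at least [size l]. *)
Lemma size_index_set n l : (0 < n)%N -> index_set n l -> (size l <= n)%N.
Proof.
rewrite /index_set lt0n => /negPf -> [l0 ln /eqP lN].
rewrite -ln (bigD1_seq (size l)) ?iota_uniq ?mem_index_iota ?l0 ?leqnn//=.
by rewrite (leq_trans _ (leq_addr _ _))// leq_pmulr// lt0n.
Qed.

Lemma sum_part n l : (size l <= n)%N ->
  (\sum_(1 <= j < (size l).+1) j * part l j)%N =
  (\sum_(j < n) j.+1 * nth 0%N l j)%N.
Proof.
move=> ln; rewrite -(big_mkord xpredT (fun j => j.+1 * nth 0%N l j)%N).
rewrite big_add1 (big_cat_nat (leq0n (size l)) ln)//=.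
rewrite [X in (_ + X)%N]big1_seq ?addn0// => j /=.
by rewrite mem_index_iota => /andP[jl _]; rewrite nth_default ?muln0.
Qed.

(** Padding a list with zeros up to length n is a bijection onto the functions of weight n, and the
    padded factors are 1 by the hypothesis on g. *)
Lemma sum_index_set (R : comNzRingType) n (g : nat -> nat -> R) : (0 < n)%N ->
  (forall j, g j 0%N = 1) ->
  \sum_(l \in index_set n) \prod_(1 <= j < (size l).+1) g j (part l j) =
  \sum_(f : {ffun 'I_n -> 'I_n.+1} | (\sum_(j < n) j.+1 * f j == n)%N)
    \prod_(j < n) g j.+1 (f j).
Proof.
move=> n0 g0; rewrite [RHS]bigfs; last 2 first.
- exact: index_enum_uniq.
- by move=> f _; rewrite mem_index_enum.
pose phi (l : seq nat) : {ffun 'I_n -> 'I_n.+1} :=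
  [ffun j : 'I_n => inord (nth 0%N l j)].
(* Every entry is bounded by the weight n, so [inord] preserves it. *)
have phiE l (j : 'I_n) : index_set n l -> phi l j = nth 0%N l j :> nat.
  move=> ln; have sl := size_index_set _ _ n0 ln; rewrite ffunE inordK// ltnS.
  move: ln; rewrite /index_set eqn0Ngt n0/= => -[_ + _].
  rewrite (sum_part _ _ sl) (bigD1 j)//= => lE.
  by rewrite -[X in (_ <= X)%N]lE (leq_trans _ (leq_addr _ _))// leq_pmull.
rewrite (@reindex_fsbig _ _ _ _ _ phi (index_set n)); last first.
  split.
  - move=> l ln; rewrite /= unfold_in; apply/eqP.
    rewrite (eq_bigr (fun j : 'I_n => j.+1 * nth 0 l j)%N).
      rewrite -sum_part ?(size_index_set _ _ n0 ln)//.
      by move: ln; rewrite /index_set eqn0Ngt n0/= => -[_ -> _].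
    by move=> j _; rewrite phiE.
  - move=> l l'; rewrite !inE => ln l'n ll'.
    have E i : nth 0%N l i = nth 0%N l' i.
      have [ni|ni] := ltnP i n.
        by rewrite -(phiE l (Ordinal ni) ln) -(phiE l' (Ordinal ni) l'n) ll'.
      by rewrite !nth_default// (leq_trans _ ni)//; apply: size_index_set.
    (* Lists with the same padded entries have the same length: otherwise the last entry of the
       longer one would be 0. *)
    apply: (@eq_from_nth _ 0%N) => [|i _]; last exact: E.
    move: ln l'n; rewrite /index_set eqn0Ngt n0/= /part.
    move=> [l0 _ lN] [l'0 _ l'N]; apply/eqP; rewrite eqn_leq; apply/andP; split.
      rewrite leqNgt; apply/negP => h; apply: lN; rewrite E nth_default//.
      by rewrite -ltnS prednK.
    rewrite leqNgt; apply/negP => h; apply: l'N; rewrite -E nth_default//.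
    by rewrite -ltnS prednK.
  (* For surjectivity, the list of values of f is stripped of its trailing zeros. *)
  - move=> f /=; rewrite unfold_in => /eqP fn.
    have [l [lf sl lN]] := trim_zeros [seq val i | i <- codom f].
    have nthf (j : 'I_n) : nth 0%N [seq val i | i <- codom f] j = f j.
      rewrite (nth_map ord0) ?size_codom ?card_ord//.
      have := nth_codom ord0 f (enum_rank j).
      by rewrite enum_rankK enum_rank_ord/= => ->.
    have sln : (size l <= n)%N.
      by rewrite (leq_trans sl)// size_map size_codom card_ord.
    have ln : (\sum_(1 <= j < (size l).+1) j * part l j)%N = n.
      rewrite (sum_part _ _ sln) -[RHS]fn; apply: eq_bigr => j _.
      by rewrite lf nthf.
    have l0 : (0 < size l)%N.
      by case: (l) ln => //=; rewrite big_geq// => E; rewrite -E in n0.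
    have lI : index_set n l.
      by rewrite /index_set eqn0Ngt n0; split => //; exact: lN.
    exists l => //; apply/ffunP => j; apply/val_inj.
    by rewrite /= phiE// lf nthf.
apply: eq_fsbigr => l; rewrite inE => ln.
have sl := size_index_set _ _ n0 ln.
under [RHS]eq_bigr do rewrite phiE//.
rewrite -(big_mkord xpredT (fun j => g j.+1 (nth 0%N l j))).
rewrite big_add1 [RHS](big_cat_nat (leq0n (size l)) sl)//=.
rewrite [X in _ * X]big1_seq ?mulr1// => j /=.
by rewrite mem_index_iota => /andP[jl _]; rewrite nth_default.
Qed.

End IndexSet.

(** * Partial sums of the Dirichlet eta function *)

Section EtaLimits.
Context {R : realType}.

Definition inv_power_sum j : R^nat :=
  fun n => \sum_(i < n) i.+1%:R^-1 ^+ j.+1.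

(* Partial sums of the Dirichlet eta function at j + 1. *)
Definition eta_sum (j N : nat) : R :=
  \sum_(i < N) (i.*2.+1%:R^-1 ^+ j.+1 - i.*2.+2%:R^-1 ^+ j.+1).

(** In the sum of all terms up to 2N the even ones must be subtracted twice, and together they are
    2^-(j+1) times the sum up to N. *)
Lemma eta_sumE j N :
  eta_sum j N = inv_power_sum j N.*2 - 2^-1 ^+ j * inv_power_sum j N.
Proof.
rewrite /eta_sum /inv_power_sum; elim: N => [|N IH].
  by rewrite double0 !big_ord0 mulr0 subr0.
rewrite doubleS !big_ord_recr/= IH.
have -> : N.*2.+2%:R = 2 * N.+1%:R :> R by rewrite -natrM mul2n.
rewrite invfM exprMn [2^-1 ^+ j.+1]exprS.
set a := N.*2.+1%:R^-1 ^+ _; set b := 2^-1 ^+ j; set c := N.+1%:R^-1 ^+ _.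
set s := \sum_(i < N.*2) _; set t := \sum_(i < N) _.
lra.
Qed.

Lemma inv_power_sum_cvg j : (0 < j)%N -> cvgn (inv_power_sum j).
Proof.
move=> j0; apply: nondecreasing_is_cvgn.
  apply/nondecreasing_seqP => n; rewrite /inv_power_sum big_ord_recr/=.
  by rewrite lerDl exprn_ge0.
exists 2 => _ [n _ <-].
(* The induction telescopes 1/(n+2)^2 <= 1/(n+1) - 1/(n+2); the exponent j+1 is at least 2. *)
suff : forall n, inv_power_sum j n.+1 <= 2 - n.+1%:R^-1.
  case: n => [_|n /(_ n) h]; first by rewrite /inv_power_sum big_ord0.
  by rewrite (le_trans h)// gerBl.
elim=> [|{}n IH]; first by rewrite /inv_power_sum big_ord1 invr1 expr1n; lra.
rewrite /inv_power_sum big_ord_recr/= -/(inv_power_sum j n.+1).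
have h : n.+2%:R^-1 ^+ j.+1 <= n.+1%:R^-1 - n.+2%:R^-1 :> R.
  apply: (@le_trans _ _ (n.+2%:R^-1 ^+ 2)).
    by rewrite ler_wiXn2l ?invr_ge0// invf_le1// ler1n.
  have -> : n.+1%:R^-1 - n.+2%:R^-1 = n.+1%:R^-1 * n.+2%:R^-1 :> R.
    have : n.+1%:R != 0 :> R by [].
    have : n.+2%:R != 0 :> R by [].
    rewrite -[n.+2]addn1 natrD => a b; field.
    by rewrite nat1r a b.
  by rewrite expr2 ler_wpM2r// lef_pV2 ?posrE// ler_nat.
by have := lerD IH h; rewrite addrA subrK.
Qed.

Lemma inv_power_sum_zeta j : (0 < j)%N ->
  inv_power_sum j @ \oo --> (riemann_zeta j.+1%:R : R).
Proof.
move=> j0; rewrite /riemann_zeta.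
rewrite (_ : series _ = inv_power_sum j); first exact: inv_power_sum_cvg.
apply/funext => n; rewrite /series/= /inv_power_sum big_mkord.
by apply: eq_bigr => i _; rewrite powRN powR_mulrn// exprVn.
Qed.

Lemma cvg_double (u : R^nat) (l : R) : u @ \oo --> l ->
  (fun n => u n.*2) @ \oo --> l.
Proof.
move=> ul; apply: (@cvg_comp _ _ _ double u _ \oo) => //.
apply/cvgnyPge => A; near=> n.
rewrite -addnn (leq_trans _ (leq_addr _ _))//; near: n; exact: nbhs_infty_ge.
Unshelve. all: by end_near. Qed.

Lemma eta_sum_cvg j : (0 < j)%N -> eta_sum j @ \oo -->
  ((1 - 2 ^ (1 - j.+1%:Z)) / j.+1%:R * riemann_zeta j.+1%:R * j.+1%:R : R).
Proof.
move=> j0; rewrite (_ : (_ * _) =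
    riemann_zeta j.+1%:R - 2^-1 ^+ j * riemann_zeta j.+1%:R).
  rewrite (_ : eta_sum j =
      fun N => inv_power_sum j N.*2 - 2^-1 ^+ j * inv_power_sum j N).
    apply: cvgB; first exact/cvg_double/inv_power_sum_zeta.
    by apply: cvgMr; exact: inv_power_sum_zeta.
  by apply/funext => N; exact: eta_sumE.
have -> : (2 : R) ^ (1 - j.+1%:Z) = 2^-1 ^+ j.
  by rewrite -[j.+1]add1n PoszD opprD addrA subrr add0r exprVn exprnN.
by rewrite mulrAC mulfVK// mulrBl mul1r.
Qed.

(** Both bounds are instances of ln (1 + x) <= x, at x = 1/m and at x = -1/(m+1). *)
Lemma ln_succ_bounds m : (0 < m)%N ->
  ln (m.+1%:R : R) - ln m%:R <= m%:R^-1 /\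
  m.+1%:R^-1 <= ln (m.+1%:R : R) - ln m%:R.
Proof.
move=> m0; have mR : 0 < m%:R :> R by rewrite ltr0n.
have SR : 0 < m.+1%:R :> R by [].
rewrite -ln_div ?posrE//; split.
  have -> : m.+1%:R / m%:R = 1 + m%:R^-1 :> R.
    by rewrite -add1n natrD mulrDl mulfV ?gt_eqF// mul1r addrC.
  by apply: le_ln1Dx; rewrite (lt_trans (ltrN10 _))// invr_gt0.
rewrite -[leRHS]opprK -lnV ?posrE ?divr_gt0// invf_div lerNr.
have -> : m%:R / m.+1%:R = 1 - m.+1%:R^-1 :> R.
  apply: (mulIf (lt0r_neq0 SR)).
  rewrite mulrBl mulfVK ?gt_eqF// mulVf ?gt_eqF// mul1r.
  by rewrite -[m.+1]addn1 natrD addrK.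
apply: le_ln1Dx; rewrite ltrN2 invf_lt1//.
by rewrite ltr1n.
Qed.

(** The partial sum is a block of the harmonic series over a doubling range, on which the increments
    of ln telescope to ln 2. *)
Lemma eta_sum0_cvg : eta_sum 0 @ \oo --> (ln 2 : R).
Proof.
have E N : eta_sum 0 N.+1 = \sum_(N.+1 <= i < N.+1.*2) i.+1%:R^-1.
  rewrite eta_sumE expr0 mul1r /inv_power_sum.
  rewrite -!(big_mkord xpredT (fun i => i.+1%:R^-1 ^+ 1)).
  rewrite (@big_cat_nat _ _ _ N.+1)/= ?leq_double//.
    by rewrite addrAC subrr add0r.
  by rewrite -addnn leq_addr.
have T N : \sum_(N.+1 <= i < N.+1.*2) (ln (i.+1%:R : R) - ln i%:R) = ln 2.
  rewrite telescope_sumr; last by rewrite -addnn leq_addr.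
  by rewrite -ln_div ?posrE// -mul2n natrM mulfK.
rewrite -(cvg_shiftn 1)/=.
apply: (@squeeze_cvgr _ _ _ _ (fun N => ln 2 - N.+1%:R^-1) (fun=> ln 2)).
- near=> N; rewrite addn1 E; apply/andP; split.
    rewrite lerBlDr -{1}(T N).
    apply: (@le_trans _ _ (\sum_(N.+1 <= i < N.+1.*2) i%:R^-1)).
      rewrite big_nat_cond [leRHS]big_nat_cond; apply: ler_sum => i.
      rewrite andbT => /andP[Ni _]; have i0 := leq_ltn_trans (leq0n _) Ni.
      by have [] := @ln_succ_bounds i i0.
    rewrite -lerBlDr.
    (* Passing from 1/i to 1/(i+1) costs 1/(N+1) - 1/(2N+2), by telescoping. *)
    have -> : \sum_(N.+1 <= i < N.+1.*2) (i%:R^-1 : R) =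
        \sum_(N.+1 <= i < N.+1.*2) i.+1%:R^-1 -
        \sum_(N.+1 <= i < N.+1.*2) (i.+1%:R^-1 - i%:R^-1).
      by rewrite -sumrB; apply: eq_bigr => i _; rewrite subKr.
    rewrite telescope_sumr; last by rewrite -addnn leq_addr.
    by rewrite -addrA gerDl opprB addrAC subrr add0r oppr_le0 invr_ge0.
  rewrite -(T N) big_nat_cond [leRHS]big_nat_cond; apply: ler_sum => i.
  rewrite andbT => /andP[Ni _]; have i0 := leq_ltn_trans (leq0n _) Ni.
  by have [] := @ln_succ_bounds i i0.
- rewrite -[X in _ --> X]subr0; apply: cvgB; first exact: cvg_cst.
  exact: cvg_harmonic.
- exact: cvg_cst.
Unshelve. all: by end_near. Qed.

End EtaLimits.

(** * From the moment recurrence to Newton's identities *)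

Section MomentAsymptotics.
Context {R : realType}.

Lemma cvg_conv (u v : nat -> nat -> R) (u' v' : nat -> R) n :
  (forall i, (i <= n)%N -> u ^~ i @ \oo --> u' i) ->
  (forall i, (i <= n)%N -> v ^~ i @ \oo --> v' i) ->
  (fun N => conv (u N) (v N) n) @ \oo --> conv u' v' n.
Proof.
move=> uu' vv'; apply: cvg_big => [|i _]; first exact: add_continuous.
by apply: cvgM; [apply: uu'; rewrite -ltnS|apply: vv'; exact: leq_subr].
Qed.

(** Each coefficient is a fixed polynomial expression in finitely many power sums, so limits pass
    through the recursion. *)
Lemma newton_cvg (p e : nat -> nat -> R) (p' e' : nat -> R) :
  (forall N, newton (p N) (e N)) -> newton p' e' ->
  (forall j, p ^~ j @ \oo --> p' j) -> forall n, e ^~ n @ \oo --> e' n.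
Proof.
move=> pe pe' pp'; elim/ltn_ind => -[|n] IH.
  rewrite (proj1 pe') (_ : e ^~ 0%N = fun=> 1); first exact: cvg_cst.
  by apply/funext => N; rewrite (proj1 (pe N)).
have n1 : n.+1%:R != 0 :> R by rewrite pnatr_eq0.
have E (q f : nat -> R) : newton q f -> f n.+1 = n.+1%:R^-1 * conv q f n.
  by move=> [_ /(_ n)]; rewrite /der => <-; rewrite mulKf.
rewrite (E _ _ pe') (_ : e ^~ n.+1 = fun N => n.+1%:R^-1 * conv (p N) (e N) n).
  apply: cvgMr; apply: cvg_conv => i ni; first exact: pp'.
  exact: IH.
by apply/funext => N; exact: E.
Qed.

(* The coefficients of
   prod_(i < N) (1 - X / (2 i + 2)) / (1 - X / (2 i + 1)). *)
Fixpoint wallis_prod N : nat -> R :=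
  if N is N'.+1 then conv (wallis_prod N')
    (conv (fun n => N'.*2.+1%:R^-1 ^+ n) (binom1 N'.*2.+2%:R^-1))
  else conv1.

Lemma newton_wallis_prod N : newton (eta_sum ^~ N) (wallis_prod N).
Proof.
elim: N => [|N IH].
  rewrite (_ : eta_sum ^~ _ = fun=> 0); first exact: newton0.
  by apply/funext => j; rewrite /eta_sum big_ord0.
rewrite (_ : eta_sum ^~ N.+1 = eta_sum ^~ N \+
  ((fun j => N.*2.+1%:R^-1 ^+ j.+1) \+ (fun j => - N.*2.+2%:R^-1 ^+ j.+1))).
  exact: newton_conv IH (newton_conv _ _ _ _ (newton_geometric _)
                                             (newton_linear _)).
by apply/funext => j; rewrite /eta_sum big_ord_recr.
Qed.

Section Moments.
(** [L n N] stands for A_n(2N). [rec0] and [recS] are the coefficients of the recurrence for A(s),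
    and [bound] is what makes the higher coefficients of B_N negligible. *)
Variable L : nat -> nat -> R.
Hypothesis L0_gt0 : forall N, 0 < L 0 N.
Hypothesis L_ge0 : forall n N, 0 <= L n N.
Hypothesis rec0 : forall N, N.*2.+2%:R * L 0 N.+1 = N.*2.+1%:R * L 0 N.
Hypothesis recS : forall n N,
  N.*2.+2%:R * L n.+1 N.+1 - L n N.+1 = N.*2.+1%:R * L n.+1 N - L n N.
Hypothesis bound : forall n N, N.*2%:R ^+ n * L n N.*2 <= L 0 N.

Let B N n := L n N / L 0 N.

Let B0 N : B N 0 = 1. Proof. by rewrite /B mulfV ?gt_eqF. Qed.

(** This is the recurrence divided by (2N+2) A_0(2N+2) = (2N+1) A_0(2N). *)
Let conv_B N : conv (binom1 N.*2.+2%:R^-1) (B N.+1) =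
               conv (binom1 N.*2.+1%:R^-1) (B N).
Proof.
apply/funext => -[|n]; first by rewrite /conv !big_ord1/= !B0.
rewrite !conv_binom1S /B.
have d1 : N.*2.+1%:R != 0 :> R by rewrite pnatr_eq0.
have d2 : N.*2.+2%:R != 0 :> R by rewrite pnatr_eq0.
have L0 : L 0 N != 0 by rewrite gt_eqF.
have -> : L 0 N.+1 = N.*2.+2%:R^-1 * (N.*2.+1%:R * L 0 N).
  by rewrite -rec0 mulKf.
have := recS n N; move: d1 d2; move: N.*2.+1%:R N.*2.+2%:R => a b.
move=> a0 b0 h.
have -> : L n.+1 N.+1 / (b^-1 * (a * L 0 N)) -
    b^-1 * (L n N.+1 / (b^-1 * (a * L 0 N))) =
  (b * L n.+1 N.+1 - L n N.+1) / (a * L 0 N).  by field; rewrite a0 b0 L0.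
by rewrite h; field; rewrite a0 L0.
Qed.

Let conv_wallis N : conv (wallis_prod N) (B N) = B 0.
Proof.
elim: N => [|N <-]; first by rewrite conv1l.
rewrite /= -!convA conv_B (convA (fun n => _ ^+ n)).
by rewrite conv_geometric_linear conv1l.
Qed.

(** By [rec0] the quantity 2N A_0(2N) is nondecreasing in N; it is compared at N and at 2N. *)
Let L0_double N : L 0 N <= 2 * L 0 N.*2.
Proof.
case: N => [|N]; first by rewrite double0 ler_peMl// ler1n.
have h j : N.+1.*2%:R * L 0 N.+1 <= (N.+1 + j).*2%:R * L 0 (N.+1 + j)%N.
  elim: j => [|j IH]; first by rewrite addn0.
  rewrite addnS [_.+1.*2]doubleS (rec0 (N.+1 + j)) (le_trans IH)//.
  by rewrite ler_wpM2r ?L_ge0// ler_nat.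
have := h N.+1; rewrite addnn -[N.+1.*2.*2]mul2n natrM (mulrC 2).
by rewrite -mulrA ler_pM2l// ltr0n.
Qed.

Let B_cvg n : (fun N => B N.*2 n) @ \oo --> ((n == 0%N)%:R : R).
Proof.
case: n => [|n].
  rewrite (_ : (fun _ => _) = fun=> 1); first exact: cvg_cst.
  by apply/funext => N; exact: B0.
rewrite -(cvg_shiftn 1)/=.
apply: (@squeeze_cvgr _ _ _ _ (fun=> 0) (@harmonic R)); last 2 first.
- exact: cvg_cst.
- exact: cvg_harmonic.
near=> N; rewrite /B addn1 divr_ge0//=.
rewrite ler_pdivrMr//.
have N2 : 0 < N.+1.*2%:R :> R by rewrite ltr0n.
have NR : 0 < N.+1%:R :> R by [].
rewrite -(ler_pM2l N2).
(* A single factor 2(N+1) from [bound] suffices: with [L0_double] it leaves the ratio at most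
   2/(2(N+1)), the harmonic term. *)
apply: (@le_trans _ _ (N.+1.*2%:R ^+ n.+1 * L n.+1 N.+1.*2)).
  by rewrite ler_wpM2r// -[leLHS]expr1 ler_weXn2l// ler1n.
rewrite (le_trans (bound _ _))// (le_trans (L0_double _))//.
by rewrite -mul2n natrM -!mulrA mulVKf// gt_eqF.
Unshelve. all: by end_near. Qed.

(** By [conv_wallis] the product of [wallis_prod] and B does not depend on N, while along even
    indices its factors tend to e and to 1. *)
Lemma moment_newton (p e : nat -> R) n : newton p e ->
  (forall j, eta_sum j @ \oo --> p j) -> L n 0 = L 0 0 * e n.
Proof.
move=> pe etap.
suff -> : e n = L n 0 / L 0 0 by rewrite mulrC divfK// gt_eqF.
have h : (fun N => conv (wallis_prod N.*2) (B N.*2) n) @ \oo --> conv e conv1 n.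
  apply: cvg_conv => i _; last exact: B_cvg.
  apply: (cvg_double (wallis_prod ^~ i)).
  exact: newton_cvg newton_wallis_prod pe _ _.
rewrite convC conv1l in h.
rewrite (_ : (fun _ => _) = fun=> B 0 n) in h; last first.
  by apply/funext => N; rewrite conv_wallis.
exact: (cvg_unique _ h (cvg_cst _)).
Qed.

End Moments.
End MomentAsymptotics.

(** * Integrals over an open interval *)

Section ImproperFTC.
Context {R : realType}.
Notation mu := (@lebesgue_measure R).
Variables (a b A B : R) (f F : R -> R).
Hypothesis ab : a < b.
Hypothesis cf : forall x, a < x < b -> {for x, continuous f}.
Hypothesis dF : forall x, a < x < b -> is_derive x 1 F (f x).
Hypothesis Fa : F x @[x --> a^'+] --> A.
Hypothesis Fb : F x @[x --> b^'-] --> B.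

(** The denominator starts at 3 so that the two margins never meet and [a + e_n, b - e_n] is a
    proper interval. *)
Let e n : R := (b - a) / n.+3%:R.
Let I n := `[a + e n, b - e n].

Let e_gt0 n : 0 < e n. Proof. by rewrite divr_gt0// subr_gt0. Qed.

Let e_cvg : e @ \oo --> (0 : R).
Proof.
rewrite -[X in _ --> X](mulr0 (b - a)); apply: cvgMr.
rewrite (_ : (fun _ => _) = fun n => harmonic (n + 2)%N).
  by rewrite cvg_shiftn; exact: cvg_harmonic.
by apply/funext => n /=; rewrite addn2.
Qed.

Let e_lt n : a + e n < b - e n.
Proof.
suff : 2 * e n < b - a by move: (e n) => x; lra.
rewrite /e mulrCA gtr_pMr ?subr_gt0// ltr_pdivrMr// mul1r.
by rewrite ltr_nat.
Qed.

Let I_sub n x : x \in I n -> a < x < b.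
Proof.
rewrite in_itv/= => /andP[h1 h2]; have := e_gt0 n.
by move: h1 h2; move: (e n) => y; lra.
Qed.

Let bigcup_I : \bigcup_n [set` I n] = `]a, b[%classic.
Proof.
apply/seteqP; split => [x [n _ /I_sub]|x]; first by rewrite /= in_itv.
rewrite /= in_itv/= => /andP[ax xb].
have m0 : 0 < Num.min (x - a) (b - x) by rewrite lt_min !subr_gt0 ax xb.
move/cvgrPdist_lt : e_cvg => /(_ _ m0)[n _ /(_ n (leqnn n))].
rewrite sub0r normrN gtr0_norm// lt_min => /andP[h1 h2].
exists n => //=; rewrite in_itv/=; move: h1 h2; move: (e n) => y; lra.
Qed.

Let nd_I : nondecreasing_seq (fun n => [set` I n]).
Proof.
move=> n m nm; apply/subsetPset => x /=; rewrite !in_itv/=.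
have : e m <= e n.
  by rewrite /e ler_wpM2l ?subr_ge0 ?(ltW ab)// lef_pV2 ?posrE// ler_nat.
by move: (e m) (e n) => y z h /andP[h1 h2]; lra.
Qed.

Let mf : measurable_fun `]a, b[ f.
Proof.
apply: open_continuous_measurable_fun => // x.
by rewrite inE/= in_itv/=; exact: cf.
Qed.

Let FTC_I n : (\int[mu]_(x in [set` I n]) (f x)%:E =
               (F (b - e n) - F (a + e n))%:E)%E.
Proof.
have cF x : a < x < b -> {for x, continuous F}.
  move=> /dF xF; apply: differentiable_continuous.
  by apply/derivable1_diffP; case: xF.
have ea : a < a + e n < b.
  by have := e_gt0 n; have := e_lt n; move: (e n) => y; lra.
have eb : a < b - e n < b.
  by have := e_gt0 n; have := e_lt n; move: (e n) => y; lra.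
rewrite EFinB; apply: continuous_FTC2 (e_lt n) _ _ _.
- apply: continuous_in_subspaceT => x; rewrite inE => /I_sub; exact: cf.
- split.
  + move=> x xI; have [] // := dF x _; apply: (I_sub n).
    by apply: subset_itv_oo_cc xI.
  + exact/cvg_at_right_filter/cF.
  + exact/cvg_at_left_filter/cF.
- move=> x xI; rewrite derive1E.
  have [] // := dF x _; apply: (I_sub n).
  by apply: subset_itv_oo_cc xI.
Qed.

Let FTC_I_cvg :
  (fun n => \int[mu]_(x in [set` I n]) (f x)%:E)%E @ \oo --> (B - A)%:E.
Proof.
under eq_fun do rewrite FTC_I; apply: cvg_EFin; first exact: nearW.
rewrite /comp/=; apply: cvgB.
  move/cvg_at_leftP : Fb; apply; split.
    by move=> n; have := e_gt0 n; move: (e n) => y; lra.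
  by rewrite -[X in _ --> X]subr0; apply: cvgB; [exact: cvg_cst|].
move/cvg_at_rightP : Fa; apply; split.
  by move=> n; have := e_gt0 n; move: (e n) => y; lra.
by rewrite -[X in _ --> X]addr0; apply: cvgD; [exact: cvg_cst|].
Qed.

(** Monotone convergence along the exhausting compact intervals; integrability of f is then a
    consequence. *)
Lemma ge0_improper_FTC2 : (forall x, a < x < b -> 0 <= f x) ->
  (\int[mu]_(x in `]a, b[) (f x)%:E = (B - A)%:E)%E.
Proof.
move=> f0; rewrite -bigcup_I; apply: cvg_unique FTC_I_cvg => //.
apply: ge0_nondecreasing_set_cvg_integral => // n.
  apply/measurable_EFinP; apply: measurable_funS mf => // x /I_sub.
  by rewrite /= in_itv.
by move=> x /I_sub /f0; rewrite lee_fin.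
Qed.

(** For f of variable sign, dominated convergence with majorant |f| replaces monotone
    convergence. *)
Lemma improper_FTC2 : mu.-integrable `]a, b[ (EFin \o f) ->
  (\int[mu]_(x in `]a, b[) (f x)%:E = (B - A)%:E)%E.
Proof.
move=> fi.
have subI n : [set` I n] `<=` `]a, b[%classic.
  by move=> x /I_sub; rewrite /= in_itv.
have E n : (\int[mu]_(x in [set` I n]) (f x)%:E =
    \int[mu]_(x in `]a, b[) ((EFin \o f) \_ [set` I n]) x)%E.
  by rewrite -integral_mkcondr setIidr.
move: FTC_I_cvg; rewrite (funext E).
apply: cvg_unique => //.
have [||||||_ _] := @dominated_convergence _ _ _ mu `]a, b[%classic _
  (fun n => (EFin \o f) \_ [set` I n]) (EFin \o f) (abse \o (EFin \o f)) => //.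
- move=> n; apply/measurable_restrict => //.
  rewrite setIidr//; apply/measurable_EFinP.
  exact: measurable_funS mf.
- exact/measurable_EFinP.
- apply: aeW => x xab; apply: cvg_near_cst.
  move: xab; rewrite -bigcup_I => -[n _ xn]; near=> m.
  rewrite patchE mem_set//.
  by move: x xn; apply/subsetPset/nd_I; near: m; exact: nbhs_infty_ge.
- exact: integrable_abse.
- apply: aeW => x n _; rewrite patchE; case: ifPn => // _.
  by rewrite abse0 /= lee_fin.
Unshelve. all: by end_near. Qed.

End ImproperFTC.

(** * Logarithmic moments of dx / sqrt (1 - x^2) *)

Section LogMoments.
Context {R : realType}.
Notation mu := (@lebesgue_measure R).
Implicit Types (n s : nat) (t : R).

(** For 0 < t < 1, the iterated integral of n copies of dx/x over t < x_1 < ... < x_n < 1. *)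
Definition nlog n t : R := (- ln t) ^+ n / n`!%:R.

Lemma nlog_ge0 n t : 0 < t < 1 -> 0 <= nlog n t.
Proof.
by move=> /ln_lt0 t0; rewrite /nlog divr_ge0// exprn_ge0// oppr_ge0 ltW.
Qed.

(** The left side is one term of the exponential series at - c ln t, all of whose terms are
    nonnegative. The values c = 1/2 and c = N are used below. *)
Lemma nlog_le_exp n (c t : R) : 0 < t < 1 -> 0 <= c ->
  c ^+ n * nlog n t <= expR (- (c * ln t)).
Proof.
move=> /ln_lt0 t0 c0; rewrite -mulrN /nlog mulrA -exprMn.
have ct : 0 <= c * - ln t by rewrite mulr_ge0// oppr_ge0 ltW.
case: n => [|n].
  by rewrite expr0 fact0 divr1 (le_trans _ (expR_ge1Dx _))// lerDl.
by rewrite (le_trans _ (expR_ge1Dxn n ct))// lerDr.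
Qed.

Lemma expR_half_ln t : 0 < t -> expR (- (2^-1 * ln t)) = (Num.sqrt t)^-1.
Proof.
move=> t0; rewrite expRN; congr (_^-1).
rewrite -(@lnK _ t) ?posrE// expRK mulrC.
by rewrite expRM powR12_sqrt// ltW// expR_gt0.
Qed.

Lemma nlog_le_sqrt n t : 0 < t < 1 -> nlog n t <= 2 ^+ n * (Num.sqrt t)^-1.
Proof.
move=> t01; have /andP[t0 _] := t01.
rewrite -ler_pdivrMl ?exprn_gt0// -exprVn -expR_half_ln//.
by rewrite nlog_le_exp// invr_ge0.
Qed.

Lemma nlog_le_natpow n N t : 0 < t < 1 -> N%:R ^+ n * nlog n t * t ^+ N <= 1.
Proof.
move=> t01; have /andP[t0 _] := t01.
rewrite -ler_pdivlMr ?exprn_gt0// mul1r.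
rewrite (le_trans (nlog_le_exp _ _ _ t01 _))//.
by rewrite expRN expRM_natl lnK.
Qed.

Definition dnlog n : R -> R := if n is n'.+1 then nlog n' else fun=> 0.

Lemma is_derive_nlog n t : 0 < t -> is_derive t 1 (nlog n) (- dnlog n t / t).
Proof.
move=> t0; have dl : is_derive t 1 (fun t => - ln t) (- t^-1).
  by apply: is_deriveN; exact: is_derive1_ln.
case: n => [|n].
  rewrite /= oppr0 mul0r (_ : nlog 0 = cst 1); first exact: is_derive_cst.
  by apply/funext => x; rewrite /nlog expr0 fact0 divr1.
have -> : nlog n.+1 = n.+1`!%:R^-1 \*: ((fun t => - ln t) ^+ n.+1).
  by apply/funext => x; rewrite /nlog fctE/= mulrC.
apply: is_derive_eq.
rewrite /= /nlog /GRing.scale/= factS natrM.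
have n1 : n.+1%:R != 0 :> R by rewrite pnatr_eq0.
have nf : n`!%:R != 0 :> R by rewrite pnatr_eq0 -lt0n fact_gt0.
have t1 : t != 0 by rewrite gt_eqF.
rewrite -mulr_natl.
move: n1; move: n.+1%:R => m m0.
by field; rewrite m0 nf t1.
Qed.

End LogMoments.

Section SineMoments.
Context {R : realType}.
Notation mu := (@lebesgue_measure R).
Notation I01 := `](0%R : R), 1%R[%classic.
Implicit Types (n s : nat) (t : R).

Let sqr_gt0 t : 0 < t < 1 -> 0 < 1 - t ^+ 2.
Proof. by move=> /andP[t0 t1]; rewrite subr_gt0 expr_lt1// ltW. Qed.

Lemma omega_gt0 t : 0 < t < 1 -> 0 < omega t.
Proof. by move=> t01; rewrite invr_gt0 sqrtr_gt0 sqr_gt0. Qed.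

Lemma continuous_nlog n t : 0 < t -> {for t, continuous (nlog n)}.
Proof.
move=> t0; apply/differentiable_continuous/derivable1_diffP.
by case: (is_derive_nlog n _ t0).
Qed.

Lemma is_derive_sqrt_1sub t : 0 < t < 1 ->
  is_derive t 1 (fun x => Num.sqrt (1 - x ^+ 2)) (- (t * omega t)).
Proof.
move=> t01; have s0 := sqr_gt0 _ t01.
have d : is_derive t 1 (fun x : R => 1 - x ^+ 2) (- (t *+ 2)).
  by apply: is_derive_eq; rewrite /GRing.scale/= mulr1 add0r mul1r mulr2n.
have := @is_derive1_comp _ Num.sqrt (fun x => 1 - x ^+ 2) t _ _
  (is_derive1_sqrt s0) d.
rewrite (_ : _ * - _ = - (t * omega t))//.
rewrite /omega invfM -mulr_natl.
have : Num.sqrt (1 - t ^+ 2) != 0 by rewrite gt_eqF// sqrtr_gt0.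
by move: (Num.sqrt _) => q q0; field.
Qed.

Lemma continuous_omega t : 0 < t < 1 -> {for t, continuous omega}.
Proof.
move=> t01; apply: cvgV; first by rewrite gt_eqF// sqrtr_gt0 sqr_gt0.
have c : {for t, continuous (fun x : R => Num.sqrt (1 - x ^+ 2))}.
  apply/differentiable_continuous/derivable1_diffP.
  by case: (is_derive_sqrt_1sub _ t01).
exact: c.
Qed.

Definition moment_fun n s t := t ^+ s * nlog n t * omega t.

Lemma moment_fun_ge0 n s t : 0 < t < 1 -> 0 <= moment_fun n s t.
Proof.
move=> t01; have /andP[/ltW t0 _] := t01; have w0 := ltW (omega_gt0 _ t01).
by apply: mulr_ge0 => //; apply: mulr_ge0; [exact: exprn_ge0|exact: nlog_ge0].
Qed.

Lemma continuous_moment_fun n s t : 0 < t < 1 ->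
  {for t, continuous (moment_fun n s)}.
Proof.
move=> t01; have /andP[t0 _] := t01.
apply: cvgM; last exact: continuous_omega.
by apply: cvgM; [exact: exprn_continuous|exact: continuous_nlog].
Qed.

Lemma measurable_moment_fun n s : measurable_fun I01 (moment_fun n s).
Proof.
apply: open_continuous_measurable_fun => // t.
by rewrite inE/= in_itv/=; exact: continuous_moment_fun.
Qed.

(** A majorant, up to the factor 2^n, with an elementary primitive: the first term absorbs the
    logarithms at 0, the second the singularity of [omega] at 1. *)
Let dom t : R := (Num.sqrt t)^-1 + (Num.sqrt (1 - t))^-1.

Let moment_fun_dom n s t : 0 < t < 1 -> moment_fun n s t <= 2 ^+ n * dom t.
Proof.
move=> t01; have /andP[t0 t1] := t01.
have p0 : 0 < Num.sqrt t by rewrite sqrtr_gt0.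
have q0 : 0 < Num.sqrt (1 - t) by rewrite sqrtr_gt0 subr_gt0.
(* This is t^2 <= t on ]0, 1[. *)
have w : omega t <= (Num.sqrt (1 - t))^-1.
  rewrite lef_pV2 ?posrE ?sqrtr_gt0 ?subr_gt0 ?sqr_gt0//.
    rewrite ler_sqrt ?subr_ge0 ?lerD2l ?lerN2 ?expr_le1 ?ltW ?sqr_gt0//.
    by rewrite expr2 gtr_pMl.
  by rewrite -subr_gt0 sqr_gt0.
apply: (@le_trans _ _ (2 ^+ n * ((Num.sqrt t)^-1 * (Num.sqrt (1 - t))^-1))).
  rewrite /moment_fun mulrA ler_pM//.
  - by rewrite mulr_ge0 ?exprn_ge0 ?nlog_ge0// ltW.
  - by rewrite ltW// omega_gt0.
  rewrite (le_trans _ (nlog_le_sqrt n _ t01))// ler_piMl ?nlog_ge0//.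
  by rewrite exprn_ile1// ltW.
rewrite ler_pM2l ?exprn_gt0//.
(* With p^2 + q^2 = 1 and p, q in [0, 1] one has p + q >= 1, hence 1/(p q) <= (p + q)/(p q) = 1/p +
   1/q. *)
have pq : 1 <= Num.sqrt t + Num.sqrt (1 - t).
  have p1 : Num.sqrt t <= 1 by rewrite -sqrtr1 ler_sqrt// ltW.
  have q1 : Num.sqrt (1 - t) <= 1 by rewrite -[leRHS]sqrtr1 ler_sqrt//; lra.
  have : Num.sqrt t ^+ 2 + Num.sqrt (1 - t) ^+ 2 = 1.
    by rewrite !sqr_sqrtr; lra.
  move: p0 q0 p1 q1; move: (Num.sqrt t) (Num.sqrt (1 - t)) => p q; nra.
rewrite /dom; move: p0 q0 pq.
move: (Num.sqrt t) (Num.sqrt (1 - t)) => p q p0 q0 pq.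
have -> : p^-1 + q^-1 = p^-1 * q^-1 * (p + q).
  by field; rewrite !gt_eqF.
by rewrite ler_peMr// mulr_ge0 ?invr_ge0 ?ltW.
Qed.

Let integrable_dom : mu.-integrable I01 (EFin \o dom).
Proof.
pose G t : R := 2 * Num.sqrt t - 2 * Num.sqrt (1 - t).
have cdom t : 0 < t < 1 -> {for t, continuous dom}.
  move=> /andP[t0 t1]; apply: cvgD; apply: cvgV.
  - by rewrite gt_eqF// sqrtr_gt0.
  - exact: sqrt_continuous.
  - by rewrite gt_eqF// sqrtr_gt0 subr_gt0.
  - apply: continuous_comp; last exact: sqrt_continuous.
    by apply: cvgB => //; exact: cvg_cst.
have cG : continuous G.
  move=> t; apply: cvgB; apply: cvgMr; first exact: sqrt_continuous.
  apply: continuous_comp; last exact: sqrt_continuous.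
  by apply: cvgB => //; exact: cvg_cst.
have dom0 t : 0 < t < 1 -> 0 <= dom t.
  by move=> _; rewrite addr_ge0 ?invr_ge0 ?sqrtr_ge0.
have dG t : 0 < t < 1 -> is_derive t 1 G (dom t).
  move=> /andP[t0 t1]; have t1' : 0 < 1 - t by rewrite subr_gt0.
  have d1 := is_derive1_sqrt t0.
  have d0 : is_derive t 1 (fun x : R => 1 - x) (- 1).
    by apply: is_derive_eq; rewrite add0r mul1r.
  have d2 := @is_derive1_comp _ Num.sqrt (fun x => 1 - x) t _ _
    (is_derive1_sqrt t1') d0.
  have := is_deriveB (is_deriveZ 2 d1) (is_deriveZ 2 d2).
  rewrite (_ : _ - _ = dom t)//.
  rewrite /dom /GRing.scale/= !invfM mulrN1 mulrN opprK.
  by rewrite !mulrA mulfV// !mul1r.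
apply/integrableP; split.
  apply/measurable_EFinP; apply: open_continuous_measurable_fun => // t.
  by rewrite inE/= in_itv/=; exact: cdom.
have E : (\int[mu]_(t in I01) (dom t)%:E = (G 1 - G 0)%:E)%E.
  apply: (@ge0_improper_FTC2 R 0 1 (G 0) (G 1) dom G) => //.
  - exact/cvg_at_right_filter/cG.
  - exact/cvg_at_left_filter/cG.
rewrite (_ : (\int[_]_(_ in _) _)%E = (G 1 - G 0)%:E) ?ltry//.
rewrite -E; apply: eq_integral => t; rewrite inE/= in_itv/= => /dom0 h.
by rewrite ger0_norm.
Qed.

Lemma integrable_moment n s : mu.-integrable I01 (EFin \o moment_fun n s).
Proof.
have h := @integrableZl _ _ _ mu I01 (measurable_itv _)
  (2 ^+ n) _ integrable_dom.
apply: le_integrable h => //.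
- apply/measurable_EFinP; exact: (measurable_moment_fun n s).
- move=> t; rewrite /= in_itv/= => t01.
  rewrite lee_fin ger0_norm ?moment_fun_ge0//.
  by rewrite (le_trans (moment_fun_dom n s _ t01))// ler_norm.
Qed.

Definition moment n s : R := \int[mu]_(t in I01) moment_fun n s t.

Lemma momentE n s :
  (\int[mu]_(t in I01) (moment_fun n s t)%:E = (moment n s)%:E)%E.
Proof.
rewrite /moment /Rintegral fineK//.
by apply: integrable_fin_num => //; exact: integrable_moment.
Qed.

Lemma moment_ge0 n s : 0 <= moment n s.
Proof.
by apply: Rintegral_ge0 => t; rewrite /= in_itv/=; exact: moment_fun_ge0.
Qed.

Let dmoment_fun n s := if n is n'.+1 then moment_fun n' s else fun=> 0.

Let dmoment_funE n s t : dmoment_fun n s t = t ^+ s * dnlog n t * omega t.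
Proof. by case: n => //=; rewrite mulr0 mul0r. Qed.

Let integrable_dmoment n s : mu.-integrable I01 (EFin \o dmoment_fun n s).
Proof. by case: n => [|n]; [exact: integrable0|exact: integrable_moment]. Qed.

(** The shifted moment A_(n-1)(s), with A_(-1) = 0: multiplication of A(s) by X. *)
Definition dmoment n s : R := if n is n'.+1 then moment n' s else 0.

Let dmomentE n s : \int[mu]_(t in I01) dmoment_fun n s t = dmoment n s.
Proof. by case: n => //=; rewrite Rintegral_cst// mul0r. Qed.

(* Integration of the derivative of [t ^ (s+1) * nlog n t * sqrt (1 - t^2)],
   which vanishes at both ends. *)
Lemma moment_rec n s :
  s.+2%:R * moment n s.+2 - dmoment n s.+2 = s.+1%:R * moment n s - dmoment n s.
Proof.
pose F t : R := t ^+ s.+1 * nlog n t * Num.sqrt (1 - t ^+ 2).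
pose f t : R := (s.+1%:R * moment_fun n s t - dmoment_fun n s t) -
                (s.+2%:R * moment_fun n s.+2 t - dmoment_fun n s.+2 t).
have i1 (c : R) r :
    mu.-integrable I01 (EFin \o (fun t => c * moment_fun n r t)).
  by have := @integrableZl _ _ _ mu I01 (measurable_itv _) c _
    (integrable_moment n r).
have i2 (c : R) r : mu.-integrable I01
    (EFin \o (fun t => c * moment_fun n r t - dmoment_fun n r t)).
  by have := @integrableB _ _ _ mu I01 (measurable_itv _) _ _ (i1 c r)
    (integrable_dmoment n r).
have i3 : mu.-integrable I01 (EFin \o f).
  by have := @integrableB _ _ _ mu I01 (measurable_itv _) _ _
    (i2 s.+1%:R s) (i2 s.+2%:R s.+2).
have If : \int[mu]_(t in I01) f t =
  (s.+1%:R * moment n s - dmoment n s) -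
  (s.+2%:R * moment n s.+2 - dmoment n s.+2).
  rewrite RintegralB// !RintegralB// !RintegralZl//;
    try exact: integrable_moment.
  by rewrite !dmomentE.
suff I0 : \int[mu]_(t in I01) f t = 0.
  by apply/esym/eqP; rewrite -subr_eq0 -If I0.
have dF t : 0 < t < 1 -> is_derive t 1 F (f t).
  move=> t01; have /andP[t0 _] := t01.
  have d1 := is_derive_nlog n _ t0.
  have d2 := is_derive_sqrt_1sub _ t01.
  have -> : F = (id ^+ s.+1) * nlog n * (fun t => Num.sqrt (1 - t ^+ 2)).
    by apply/funext => x; rewrite /F !fctE.
  apply: is_derive_eq.
  rewrite /f !dmoment_funE /moment_fun /GRing.scale/= !fctE.
  (* All terms of the derivative become multiples of [omega t], with powers t^s and t^(s+2). *)
  have -> : Num.sqrt (1 - t ^+ 2) = (1 - t ^+ 2) * omega t.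
    apply: (mulIf (_ : Num.sqrt (1 - t ^+ 2) != 0)).
      by rewrite gt_eqF// sqrtr_gt0 sqr_gt0.
    rewrite -mulrA mulVf; last by rewrite gt_eqF// sqrtr_gt0 sqr_gt0.
    by rewrite mulr1 -expr2 sqr_sqrtr// ltW// sqr_gt0.
  rewrite mulr1 -mulr_natl.
  have t1 : t != 0 by rewrite gt_eqF.
  move: (nlog n t) (dnlog n t) (omega t) => x y z.
  rewrite !exprS; move: (t ^+ s) => u.
  by field.
have cf t : 0 < t < 1 -> {for t, continuous f}.
  move=> t01; have cd r : {for t, continuous (dmoment_fun n r)}.
    by case: (n) => [|m]; [exact: cvg_cst|exact: continuous_moment_fun].
  apply: cvgB; (apply: cvgB; last exact: cd).
    by apply: cvgMr; exact: continuous_moment_fun.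
  by apply: cvgMr; exact: continuous_moment_fun.
(* A continuous majorant of F vanishing at 0 and at 1; [nlog_le_sqrt] costs t^(-1/2), and the factor
   t of t^(s+1) pays for it. *)
pose H t : R := 2 ^+ n * (Num.sqrt t * Num.sqrt (1 - t ^+ 2)).
have cH : continuous H.
  move=> t; apply: cvgMr; apply: cvgM; first exact: sqrt_continuous.
  apply: continuous_comp; last exact: sqrt_continuous.
  by apply: cvgB; [exact: cvg_cst|exact: exprn_continuous].
have F0 t : 0 < t < 1 -> 0 <= F t.
  move=> t01; have /andP[t0 _] := t01.
  apply: mulr_ge0; last exact: sqrtr_ge0.
  by apply: mulr_ge0; [rewrite exprn_ge0// ltW|exact: nlog_ge0].
have FH t : 0 < t < 1 -> F t <= H t.
  move=> t01; have /andP[t0 t1] := t01.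
  rewrite /F /H mulrA ler_wpM2r ?sqrtr_ge0//.
  rewrite exprS -mulrA mulrC -mulrA.
  apply: (@le_trans _ _ (t * nlog n t)).
    rewrite (mulrC t); apply: ler_piMl; last by rewrite exprn_ile1// ltW.
    by apply: mulr_ge0; [exact: nlog_ge0|exact: ltW].
  apply: (@le_trans _ _ (t * (2 ^+ n * (Num.sqrt t)^-1))).
    by rewrite ler_wpM2l ?(ltW t0)// nlog_le_sqrt.
  rewrite mulrCA ler_pM2l ?exprn_gt0// -{1}(sqr_sqrtr (ltW t0)) expr2 mulfK//.
  by rewrite gt_eqF// sqrtr_gt0.
have H0 : H 0 = 0 by rewrite /H sqrtr0 mul0r mulr0.
have H1 : H 1 = 0 by rewrite /H expr1n subrr sqrtr0 !mulr0.
have Fa : F t @[t --> 0^'+] --> (0 : R).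
  apply: (@squeeze_cvgr _ _ _ _ (fun=> 0) H); last 2 first.
  - exact: cvg_cst.
  - by rewrite -[X in _ --> X]H0; apply/cvg_at_right_filter/cH.
  near=> t; have t01 : 0 < t < 1.
    by apply/andP; split; near: t; [exact: nbhs_right_gt|exact: nbhs_right_lt].
  by rewrite F0// FH.
have Fb : F t @[t --> 1^'-] --> (0 : R).
  apply: (@squeeze_cvgr _ _ _ _ (fun=> 0) H); last 2 first.
  - exact: cvg_cst.
  - by rewrite -[X in _ --> X]H1; apply/cvg_at_left_filter/cH.
  near=> t; have t01 : 0 < t < 1.
    by apply/andP; split; near: t; [exact: nbhs_left_gt|exact: nbhs_left_lt].
  by rewrite F0// FH.
rewrite /Rintegral (@improper_FTC2 R 0 1 0 0 f F)// ?subrr//.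
Unshelve. all: by end_near. Qed.

End SineMoments.

(** * Values of the moments *)

Section SineMomentValues.
Context {R : realType}.
Notation mu := (@lebesgue_measure R).
Notation I01 := `](0%R : R), 1%R[%classic.

Lemma asin_cvg_left1 : asin x @[x --> 1^'-] --> (pi / 2 : R).
Proof.
(* Capping d at pi/2 keeps pi/2 - d where sin is increasing, so x > sin (pi/2 - d) gives asin x >
   pi/2 - d. *)
apply/cvgrPdist_le => e e0; pose d := Num.min e (pi / 2).
have p0 : 0 < pi / 2 :> R by rewrite divr_gt0// pi_gt0.
have d0 : 0 < d by rewrite lt_min e0.
have dp : d <= pi / 2 by rewrite ge_min lexx orbT.
have dI : pi / 2 - d \in `[(- (pi / 2)), pi / 2].
  by rewrite in_itv/=; apply/andP; split; lra.
have pI : (pi / 2 : R) \in `[(- (pi / 2)), pi / 2].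
  by rewrite in_itv/=; apply/andP; split; lra.
have s1 : sin (pi / 2 - d) < 1.
  by rewrite -[ltRHS]sin_pihalf ltr_sin// gtrBl.
near=> x; have x1 : x < 1 by near: x; exact: nbhs_left_lt.
have x0 : 0 < x by near: x; exact: nbhs_left_gt.
have dx : sin (pi / 2 - d) < x by near: x; exact: nbhs_left_gt.
have xI' : -1 <= x <= 1.
  by rewrite (ltW x1) andbT (le_trans _ (ltW x0))// lerN10.
have xI : x \in `[(-1), 1] by rewrite in_itv/=.
have aI : asin x \in `[(- (pi / 2)), pi / 2].
  by rewrite in_itv/= asin_geNpi2// asin_lepi2.
rewrite ger0_norm ?subr_ge0 ?asin_lepi2//.
apply: (@le_trans _ _ d); last by rewrite ge_min lexx.
rewrite lerBlDr -lerBlDl ltW// -ltr_sin// asinK//.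
Unshelve. all: by end_near. Qed.

Lemma moment00 : moment 0 0 = pi / 2 :> R.
Proof.
rewrite /moment /Rintegral.
have mE t : moment_fun 0 0 t = omega t :> R.
  by rewrite /moment_fun /nlog !expr0 fact0 divr1 !mul1r.
under eq_integral do rewrite mE.
have -> : (pi / 2 : R) = pi / 2 - asin 0.
  rewrite -[X in asin X](@sin0 R) sinK ?subr0// in_itv/=.
  have p0 : 0 < pi / 2 :> R by rewrite divr_gt0// pi_gt0.
  by apply/andP; split; lra.
have dF (x : R) : 0 < x < 1 -> is_derive x 1 asin (omega x).
  by move=> /andP[x0 x1]; apply: is_derive1_asin; apply/andP; split; lra.
rewrite (@ge0_improper_FTC2 R 0 1 (asin 0) (pi / 2) omega asin)//.
- exact: continuous_omega.
- by apply/cvg_at_right_filter/continuous_asin; apply/andP; split; lra.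
- exact: asin_cvg_left1.
- by move=> x x01; rewrite ltW// omega_gt0.
Qed.

Lemma sine_moment (p e : nat -> R) n : newton p e ->
  (forall j, eta_sum j @ \oo --> p j) -> moment n 0 = pi / 2 * e n.
Proof.
move=> pe etap; rewrite -moment00.
pose L n N : R := moment n N.*2.
have rec0 N : N.*2.+2%:R * L 0 N.+1 = N.*2.+1%:R * L 0 N.
  by have := moment_rec (R:=R) 0 N.*2; rewrite /= !subr0.
(* Positivity propagates along the recurrence from the value pi/2 at N = 0. *)
have L0 N : 0 < L 0 N.
  elim: N => [|N IH]; first by rewrite /L moment00 divr_gt0// pi_gt0.
  by rewrite -(@pmulr_rgt0 _ N.*2.+2%:R)// rec0 mulr_gt0.
apply: (@moment_newton _ L L0 _ rec0 _ _ _ _ n pe etap).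
- by move=> m N; exact: moment_ge0.
- by move=> m N; exact: moment_rec m.+1 N.*2.
- move=> m N; rewrite /L /moment -RintegralZl//; last exact: integrable_moment.
  apply: le_Rintegral => //.
  + have := @integrableZl _ _ _ mu I01 (measurable_itv _)
      (N.*2%:R ^+ m) _ (integrable_moment m N.*2.*2).
    exact.
  + exact: integrable_moment.
  + move=> t; rewrite /= in_itv/= => t01; have /andP[t0 _] := t01.
    have n0 : nlog 0 t = 1 by rewrite /nlog expr0 fact0 divr1.
    rewrite /moment_fun n0 mulr1 [leLHS]mulrA.
    rewrite ler_pM2r ?omega_gt0//.
    (* Of t^(4N), one factor t^(2N) offsets (2N)^m [nlog m t] and the other remains as the weight of
       [L 0 N]. *)
    rewrite [leLHS](_ : _ =
        t ^+ N.*2 * (N.*2%:R ^+ m * nlog m t * t ^+ N.*2)); last first.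
      by rewrite -[N.*2.*2]addnn exprD; ring.
    by rewrite ler_piMr ?exprn_ge0 ?(ltW t0)// nlog_le_natpow.
Qed.

End SineMomentValues.

(** * Iterated integrals over the simplex *)

Section SimplexIntegral.
Context {R : realType}.
Notation mu := (@lebesgue_measure R).
Notation I01 := `](0%R : R), 1%R[%classic.

(** The lower end a is a parameter, so that fixing the smallest variable leaves a set of the same
    kind. *)
Definition above_simplex m (a : R) : set (m.-tuple R) :=
  [set t | path <%R a (rcons t 1)].

Lemma above_simplex_cons m (a : R) (p : R * m.-tuple R) :
  above_simplex m.+1 a (tuple_cons p) <-> a < p.1 /\ above_simplex m p.1 p.2.
Proof. by rewrite /above_simplex/=; split => [/andP[]|[-> ->]]. Qed.

Lemma above_simplex_tnth m (a : R) t i : above_simplex m a t ->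
  a < tnth t i < 1.
Proof.
rewrite /above_simplex/= (path_pairwise lt_trans)/= pairwise_rcons all_rcons.
move=> /andP[/andP[_ at_] /andP[t1 _]].
by rewrite (allP at_) ?(allP t1)// mem_tnth.
Qed.

Lemma above_simplex0 m (a : R) : 1 <= a -> above_simplex m a = set0.
Proof.
move=> a1; apply/seteqP; split => // t; rewrite /above_simplex/=.
rewrite (path_pairwise lt_trans)/= all_rcons => /andP[/andP[]].
by rewrite ltNge a1.
Qed.

Lemma measurable_above_simplex m (a : R) : measurable (above_simplex m a).
Proof.
(* The induction needs joint measurability in a and t, because the first entry of t becomes the next
   lower end. *)
suff mP : measurable_fun setT
    (fun p : R * m.-tuple R => path <%R p.1 (rcons p.2 1)).
  have mPa : measurable_fun setT (fun t : m.-tuple R => path <%R a (rcons t 1)).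
    exact: (measurable_fun_pair2 a mP).
  have := mPa measurableT [set true] I; rewrite setTI.
  by rewrite (_ : _ @^-1` _ = above_simplex m a)//; apply/seteqP; split.
elim: m => [|m IH].
  rewrite (_ : (fun _ => _) = (fun p : R * 0.-tuple R => p.1 < 1)).
    exact: measurable_fun_ltr.
  by apply/funext => -[x t]; rewrite tuple0/= andbT.
pose h (p : R * m.+1.-tuple R) : R * m.-tuple R :=
  (tnth p.2 ord0, [tuple of behead p.2]).
have mh0 : measurable_fun setT (fun p : R * m.+1.-tuple R => tnth p.2 ord0).
  exact: (measurableT_comp (measurable_tnth ord0)).
have mh : measurable_fun setT h.
  apply/measurable_fun_pairP; split => //.
  exact: (measurableT_comp (@measurable_behead _ R m) measurable_snd).
rewrite (_ : (fun _ => _) = (fun p : R * m.+1.-tuple R =>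
    (p.1 < tnth p.2 ord0) && path <%R (h p).1 (rcons (h p).2 1))).
  apply: measurable_and; first exact: measurable_fun_ltr.
  exact: (measurableT_comp IH mh).
by apply/funext => -[x t] /=; case/tupleP: t => y t; rewrite tnth0.
Qed.

Definition simplex_integral m (f : 'I_m -> R -> R) (a : R) : \bar R :=
  (\int[lebesgue_tuple m]_(t in above_simplex m a)
    (\prod_(i < m) f i (tnth t i))%:E)%E.

Lemma simplex_integral0 (f : 'I_0 -> R -> R) (a : R) : a < 1 ->
  simplex_integral 0 f a = 1%E.
Proof.
move=> a1; rewrite /simplex_integral.
rewrite (_ : above_simplex 0 a = setT); last first.
  by apply/seteqP; split => // t _; rewrite /above_simplex tuple0/= a1.
under eq_integral do rewrite big_ord0.
by rewrite integral_cst//= mul1e diracT.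
Qed.

(** Tonelli's theorem, with the smallest variable as the outer one. *)
Lemma simplex_integralS m (f : 'I_m.+1 -> R -> R) (a : R) : 0 <= a ->
  (forall i, measurable_fun I01 (f i)) ->
  (forall i x, 0 < x -> 0 <= f i x) ->
  simplex_integral m.+1 f a =
  (\int[mu]_(x in `]a, 1%R[)
     ((f ord0 x)%:E * simplex_integral m (fun i => f (lift ord0 i)) x))%E.
Proof.
move=> a0 mf f0; rewrite /simplex_integral.
set S := above_simplex m.+1 a.
pose g (t : m.+1.-tuple R) := (\prod_(i < m.+1) f i (tnth t i))%:E.
have mS : measurable S by exact: measurable_above_simplex.
have mg : measurable_fun S g.
  apply/measurable_EFinP/measurable_prod => i _.
  apply: (@measurable_comp _ _ _ _ _ _ I01) => //.
  - move=> _ [t St <-]; have /andP[t0 t1] := above_simplex_tnth _ _ _ i St.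
    by rewrite /= in_itv/= t1 (le_lt_trans a0).
  - by apply: measurable_funTS; exact: measurable_tnth.
have g0 t : S t -> (0 <= g t)%E.
  move=> St; rewrite lee_fin prodr_ge0// => i _; apply: f0.
  have /andP[t0 _] := above_simplex_tnth _ _ _ i St.
  by rewrite (le_lt_trans a0).
have mG : measurable_fun setT (g \_ S).
  by have [+ _] := measurable_restrictT g mS; apply.
have G0 t : (0 <= (g \_ S) t)%E.
  by apply: erestrict_ge0 => {}t; exact: g0.
rewrite integral_mkcond/= -/g.
rewrite ge0_integral_pushforward//; last exact: (@measurable_tuple_cons R m).
rewrite preimage_setT.
have mGc : measurable_fun setT ((g \_ S) \o (@tuple_cons R m)).
  exact: (measurableT_comp mG (@measurable_tuple_cons R m)).
rewrite (@fubini_tonelli1 _ _ _ _ _ mu (lebesgue_tuple m) _ mGc)//; last first.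
  by move=> p; exact: G0.
rewrite [RHS]integral_mkcond; apply: eq_integral => x _.
rewrite /fubini_F/= patchE.
pose G t := (\prod_(i < m) f (lift ord0 i) (tnth t i))%:E.
have E t : (g \_ S) (tuple_cons (x, t)) = if (a < x)%R
    then ((fun t => (f ord0 x)%:E * G t)%E \_ (above_simplex m x)) t else 0%E.
  have gE : g (tuple_cons (x, t)) = ((f ord0 x)%:E * G t)%E.
    rewrite /g big_ord_recl -EFinM; congr (_ * _)%:E.
    by apply: eq_bigr => i _; rewrite tnthS.
  rewrite !patchE gE; have [ax|xa] := boolP (a < x)%R; last first.
    case: ifPn => //; rewrite inE => /above_simplex_cons[ax _].
    by rewrite ax in xa.
  case: ifPn => [|].
    by rewrite inE => /above_simplex_cons[_ h]; rewrite mem_set.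
  rewrite notin_setE => h; rewrite memNset// => h'; apply: h.
  exact/above_simplex_cons.
under eq_integral do rewrite E.
have G1 t : above_simplex m x t -> (a < x)%R -> (0 <= G t)%E.
  move=> xt ax; rewrite lee_fin prodr_ge0// => i _; apply: f0.
  have /andP[t0 _] := above_simplex_tnth _ _ _ i xt.
  by rewrite (le_lt_trans a0)// (lt_trans ax).
case: ifPn => [|].
  rewrite inE/= in_itv/= => /andP[ax x1]; rewrite ax -integral_mkcond.
  rewrite ge0_integralZl_EFin//.
  - exact: measurable_above_simplex.
  - by move=> t xt; exact: G1.
  - apply/measurable_EFinP/measurable_prod => i _.
    apply: (@measurable_comp _ _ _ _ _ _ I01) => //.
    + move=> _ [t St <-]; have /andP[t0 t1] := above_simplex_tnth _ _ _ i St.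
      by rewrite /= in_itv/= t1 (le_lt_trans a0)// (lt_trans ax).
    + by apply: measurable_funTS; exact: measurable_tnth.
  - by apply: f0; rewrite (le_lt_trans a0).
(* Outside ]a, 1[ the inner integral vanishes: x <= a violates the first inequality, and x >= 1
   makes the remaining simplex empty. *)
rewrite notin_setE/= in_itv/= => xI.
have [ax|_] := boolP (a < x)%R; last by rewrite integral0.
have x1 : (1 <= x)%R by rewrite leNgt; apply/negP => x1; apply: xI; rewrite ax.
by rewrite above_simplex0// patch_set0 integral0.
Qed.

Lemma continuous_omega0 (x : R) : 0 < x -> {for x, continuous omega0}.
Proof. by move=> x0; apply: inv_continuous; rewrite gt_eqF. Qed.

Let measurable_omega0 : measurable_fun I01 omega0.
Proof.
apply: open_continuous_measurable_fun => // t.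
by rewrite inE/= in_itv/= => /andP[t0 _]; exact: continuous_omega0.
Qed.

Let omega0_ge0 (x : R) : 0 < x -> 0 <= omega0 x.
Proof. by move=> x0; rewrite invr_ge0 ltW. Qed.

(** By induction on m, since - [nlog m.+1] is a primitive of [nlog m] x / x and vanishes at 1. *)
Lemma simplex_integral_omega0 m (a : R) : 0 < a < 1 ->
  simplex_integral m (fun=> omega0) a = (nlog m a)%:E.
Proof.
elim: m a => [|m IH] a /andP[a0 a1].
  by rewrite simplex_integral0// /nlog expr0 fact0 divr1.
rewrite simplex_integralS ?(ltW a0)//.
have E x : x \in `]a, 1[ -> ((omega0 x)%:E * simplex_integral m (fun=> omega0) x
    = (omega0 x * nlog m x)%:E)%E.
  rewrite in_itv/= => /andP[ax x1].
  by rewrite IH ?EFinM// x1 (lt_trans a0).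
transitivity (\int[mu]_(x in `]a, 1%R[) (omega0 x * nlog m x)%:E)%E.
  by apply: eq_integral => x; rewrite inE; exact: E.
have dF x : a < x < 1 ->
    is_derive x 1 (fun x => - nlog m.+1 x) (omega0 x * nlog m x).
  move=> /andP[ax x1]; have x0 := lt_trans a0 ax.
  have := is_deriveN (is_derive_nlog m.+1 _ x0).
  by rewrite (_ : - (_ / x) = omega0 x * nlog m x)// mulNr opprK mulrC.
have cn x : 0 < x -> {for x, continuous (fun x => - nlog m.+1 x)}.
  by move=> x0; apply: cvgN; exact: continuous_nlog.
rewrite (@ge0_improper_FTC2 R a 1 (- nlog m.+1 a) (- nlog m.+1 1)
  (fun x => omega0 x * nlog m x) (fun x => - nlog m.+1 x))//.
- by rewrite opprK /nlog ln1 oppr0 expr0n/= mul0r oppr0 add0r.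
- move=> x /andP[ax _]; have x0 := lt_trans a0 ax.
  by apply: cvgM; [exact: continuous_omega0|exact: continuous_nlog].
- exact/cvg_at_right_filter/cn.
- exact/cvg_at_left_filter/cn.
- move=> x /andP[ax x1]; have x0 := lt_trans a0 ax.
  by rewrite mulr_ge0 ?omega0_ge0 ?nlog_ge0// x0.
Qed.

Lemma zetaF2_omega m : zetaF2 m.+1 (@omega R) = (moment m 0)%:E.
Proof.
pose f (i : 'I_m.+1) : R -> R := if i == 0%N :> nat then omega else omega0.
rewrite -momentE -[LHS]/(simplex_integral m.+1 f 0) simplex_integralS//.
- apply: eq_integral => x; rewrite inE/= in_itv/= => x01.
  rewrite /f/= simplex_integral_omega0//.
  by rewrite -EFinM /moment_fun mul1r mulrC.
- move=> i; rewrite /f; case: ifP => _ //.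
  apply: open_continuous_measurable_fun => // t.
  by rewrite inE/= in_itv/=; exact: continuous_omega.
- move=> i x x0; rewrite /f; case: ifP => _; last exact: omega0_ge0.
  by rewrite invr_ge0 sqrtr_ge0.
Qed.

End SimplexIntegral.

(** * The generating series and its expansion over partitions *)

Definition log_coef (R : realType) (j : nat) : R :=
  if j is 0%N then ln 2
  else (1 - 2 ^ (1 - j.+1%:Z)) / j.+1%:R * riemann_zeta j.+1%:R.

(** The index j = 0 stands apart: the limit ln 2 takes the place of an expression in the divergent
    zeta(1). *)
Lemma eta_sum_log_coef (R : realType) j :
  eta_sum j @ \oo --> (log_coef R j * j.+1%:R : R).
Proof.
case: j => [|j]; first by rewrite mulr1; exact: eta_sum0_cvg.
exact: eta_sum_cvg.
Qed.

Theorem proposition3p2p1 (R : realType) (k : nat) (hk : (1 <= k)%N) :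
  zetaF2 k (@omega R) =
  ((pi : R) / 2 *
   \sum_(l \in index_set k.-1)
     ((ln 2 : R) ^+ part l 1 / (part l 1)`!%:R *
      \prod_(2 <= j < (size l).+1)
        ((part l j)`!%:R^-1 *
         ((1 - 2 ^ (1 - j%:Z)) / j%:R * riemann_zeta j%:R) ^+ part l j)))%:E.

Proof.
case: k hk => // m _; rewrite zetaF2_omega [m.+1.-1]/=.
have eP := newton_exp_prod_diag (log_coef R).
rewrite (sine_moment _ _ m eP (@eta_sum_log_coef R)); congr (_ * _)%:E.
(* I_0 = {(0)} is a convention of its own, outside the scope of [sum_index_set]. *)
have [->|m0] := posnP m.
  rewrite /index_set/= fsbig_set1 /part/= big_geq// expr0 fact0 divr1 mulr1.
  by rewrite /conv1.
rewrite (newton_partitions _ _ m eP).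
pose g j l : R := log_coef R j.-1 ^+ l / l`!%:R.
rewrite -(sum_index_set R m g)//; last first.
  by move=> j; rewrite /g expr0 fact0 divr1.
apply: eq_fsbigr => l; rewrite inE /index_set eqn0Ngt m0/= => -[l0 _ _].
rewrite big_ltn//; congr (_ * _).
rewrite big_nat_cond [RHS]big_nat_cond; apply: eq_bigr => -[|[|j]]//= _.
by rewrite /g/= mulrC.
Qed.
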